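(* Let $X$ be a linear subspace of $L^0$, $s\in(0,1]$, $n\ge2$, let $\rho_1,\dots,\rho_{n-1}$ be $s$-convex semimodulars on $X$, and put $\rho=\max_{1\le i\le n-1}\rho_i$ and $X_\rho=\{x\in X:\rho(\lambda x)<\infty\text{ for some }\lambda>0\}$. Assume: (i) for any $x\in X_\rho$ and $y\in L^0$ with $|y|\le|x|$ a.e., we have $y\in X_\rho$ and $\rho_i(\lambda y)\le\rho_i(\lambda x)$ for all $\lambda>0$ and $i\in\{1,\dots,n-1\}$; (ii) there is $x\in X_\rho$ with $x>0$ a.e.; (iii) for any $(x_m)\subset X_\rho$ such that $\rho(\lambda(x_k-x_j))\to0$ as $k,j\to\infty$ for every $\lambda>0$, there is $x\in X_\rho$ with $\rho(\lambda(x_m-x))\to0$ as $m\to\infty$ for every $\lambda>0$. Let $f:\mathbb{R}^n\to[0,\infty)$ be a monotone norm and assume that $\rho_1,\dots,\rho_{n-1}$ are continuous. Suppose that for any $(x_m)\subset X_\rho$ and $x\in L^0$ we have $$\liminf_{m\to\infty}|x_m|\ge|x|\ \text{a.e.}\quad\Longrightarrow\quad\liminf_{m\to\infty}\rho_i(\lambda x_m)\ge\rho_i(\lambda x)$$ for all $i\in\{1,\dots,n-1\}$ and $\lambda>0$. Then $X_\rho$, equipped with the $s$-norm $$\|x\|_f=\inf_{k>0}\left\{k f\left(e_1+\sum_{i=2}^n\rho_{i-1}\left(\frac{x}{k^{1/s}}\right)e_i\right)\right\},$$ has the Fatou property.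
   Context: $I=[0,\alpha)$ with $\alpha=1$ or $\alpha=\infty$, with Lebesgue measure; $L^0$ is the set of (a.e. equivalence classes of) extended real-valued Lebesgue measurable functions on $I$. $(e_i)$ is the standard basis of $\mathbb{R}^n$. A function $\rho:X\to[0,\infty]$ is an $s$-convex semimodular if: $\rho(0)=0$, and $\rho(dx)=0$ for all $d\ge0$ implies $x=0$; $\rho(dx)=\rho(x)$ for scalars $|d|=1$; $\rho(ax+by)\le a^s\rho(x)+b^s\rho(y)$ for $a,b\ge0$, $a^s+b^s=1$. A semimodular $\rho_i$ is continuous if for every $x\in X_\rho$ and $\lambda_0\in(0,\infty)$, $\lim_{\lambda\to\lambda_0^-}\rho_i(\lambda x)=\rho_i(\lambda_0x)=\lim_{\lambda\to\lambda_0^+}\rho_i(\lambda x)$. A norm $f$ on $\mathbb{R}^n$ is monotone if $f(u)\le f(v)$ whenever $0\le u\le v$ coordinatewise. Conventions: $f(e_1+\sum_{i=2}^nt_ie_i)=+\infty$ if some $t_i=+\infty$; $\rho_i(z)=+\infty$ for $z\in L^0\setminus X$. Fatou property of a space $E$ with $s$-norm $\|\cdot\|_E$: whenever $(x_m)\subset E$, $x_m\ge0$, $\sup_m\|x_m\|_E<\infty$ and $x_m\uparrow x\in L^0$ a.e., then $x\in E$ and $\|x_m\|_E\uparrow\|x\|_E$. *)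

(* Defs.v *)
From HB Require Import structures.
From mathcomp Require Import all_boot all_order all_algebra.
From mathcomp Require Import all_classical all_reals all_analysis.
From mathcomp Require Import measurable_realfun measurable_fun_approximation.

Set Implicit Arguments.
Unset Strict Implicit.
Unset Printing Implicit Defensive.

Import Order.TTheory GRing.Theory Num.Theory.
Import numFieldNormedType.Exports.

Local Open Scope classical_set_scope.
Local Open Scope ring_scope.
Local Open Scope ereal_scope.

(* R with the sigma-algebra of Lebesgue (not only Borel) measurable sets, on
   which completed_lebesgue_measure is defined; as a type it is R. *)
Notation lebesgueR R :=
  (caratheodory_type (mu_ext (wlength (@idfun R)))).

Definition interval0 (R : realType) (alpha : \bar R) : set (lebesgueR R) :=
  [set t : R | (0 <= t)%R /\ t%:E < alpha].

Lemma measurable_interval0 (R : realType) (alpha : \bar R) :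
  measurable (interval0 alpha).
Proof.
have mb (A : set R) : measurable (A : set (measurableTypeR R)) ->
    measurable (A : set (lebesgueR R)) by move=> mA; exact: sub_caratheodory.
have -> : interval0 alpha =
    (([set` `[0%R, +oo[] : set R) `&` [set t : R | t%:E < alpha]).
  by apply/seteqP; split=> t /=; rewrite in_itv/= andbT.
apply: mb; apply: measurableI; first exact: measurable_itv.
case: alpha => [a| |].
- rewrite (_ : [set t : R | _] = [set` `]-oo, a[]); first exact: measurable_itv.
  by apply/seteqP; split=> t /=; rewrite in_itv/= lte_fin.
- rewrite (_ : [set t : R | _] = setT); first exact: measurableT.
  by apply/seteqP; split=> t //= _; rewrite ltry.
- rewrite (_ : [set t : R | _] = set0); first exact: measurable0.
  by apply/seteqP; split=> t /=.
Qed.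

(* Lebesgue measure on [0, alpha), seen as a measure on the whole line that
   vanishes outside [0, alpha). *)
Definition leb (R : realType) (alpha : \bar R) :
    {measure set (lebesgueR R) -> \bar R} :=
  mrestr (@completed_lebesgue_measure R) (measurable_interval0 alpha).

(* Classes of extended real-valued Lebesgue measurable functions modulo
   equality almost everywhere on [0, alpha): the values outside [0, alpha) are
   irrelevant since leb alpha vanishes there. *)
Definition L0 (R : realType) (alpha : \bar R) : Type :=
  {mfun_ (leb alpha), lebesgueR R >-> \bar R}.

Section L0_operations.
Context (R : realType) (alpha : \bar R).
Implicit Types (x y : L0 alpha) (f g : lebesgueR R -> \bar R).

(* An arbitrary representative. Every notion below that mentions it is
   independent of the choice: it is used only under L0_class or "\ae". *)
Definition fun_of_L0 x : lebesgueR R -> \bar R := repr x.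
Coercion fun_of_L0 : L0 >-> Funclass.

Lemma measurable_fun_of_L0 x : measurable_fun setT x.
Proof. exact: measurable_funPT. Qed.

Definition L0_class f (mf : measurable_fun setT f) : L0 alpha :=
  \pi_({mfun_ (leb alpha), lebesgueR R >-> \bar R})%qT
    (mfun_Sub (mem_set mf)).

Lemma L0_classK f (mf : measurable_fun setT f) :
  \forall t \ae leb alpha, L0_class mf t = f t.
Proof.
rewrite /fun_of_L0 /L0_class; case: piP => g /eqP; rewrite eqmodE => /asboolP.
by apply: filterS => t /(_ I) /= <-.
Qed.

Lemma L0_eqP x y : x = y <-> (\forall t \ae leb alpha, x t = y t).
Proof.
split=> [->|xy]; first exact: aeW.
rewrite -[x]reprK -[y]reprK; apply/eqP; rewrite eqmodE; apply/asboolP.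
by apply: filterS xy.
Qed.

Definition L0_zero : L0 alpha := L0_class (measurable_cst 0).

(* x + y, meaningful for x and y finite almost everywhere; the values where
   the sum is of the form oo - oo are conventional. *)
Definition L0_add x y : L0 alpha :=
  L0_class (emeasurable_funD (measurable_fun_of_L0 x) (measurable_fun_of_L0 y)).

Definition L0_scale (a : R) x : L0 alpha :=
  L0_class (measurable_funeM a%:E (measurable_fun_of_L0 x)).

Definition L0_sub x y : L0 alpha := L0_add x (L0_scale (-1) y).

Lemma L0_zeroE : \forall t \ae leb alpha, L0_zero t = 0.
Proof. exact: L0_classK. Qed.

Lemma L0_addE x y : \forall t \ae leb alpha, L0_add x y t = x t + y t.
Proof. exact: L0_classK. Qed.

Lemma L0_scaleE a x : \forall t \ae leb alpha, L0_scale a x t = a%:E * x t.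
Proof. exact: L0_classK. Qed.

End L0_operations.

Section definitions.
Context (R : realType) (alpha : \bar R).
Implicit Types (x y z : L0 alpha) (X E : set (L0 alpha)).

(* Addition of extended real-valued functions is a group law (x - x = 0) only
   on functions finite almost everywhere, so a linear subspace of L0 consists
   of such functions. *)
Definition linear_subspace X : Prop :=
  [/\ X (L0_zero alpha),
      forall x y, X x -> X y -> X (L0_add x y),
      forall (a : R) x, X x -> X (L0_scale a x) &
      forall x, X x -> \forall t \ae leb alpha, x t \is a fin_num].

Definition semimodular (s : R) X (rho : L0 alpha -> \bar R) : Prop :=
  [/\ forall x, X x -> 0 <= rho x,
      rho (L0_zero alpha) = 0,
      forall x, X x -> (forall d : R, (0 <= d)%R -> rho (L0_scale d x) = 0) ->
        x = L0_zero alpha,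
      forall (d : R) x, X x -> `|d|%R = 1%R -> rho (L0_scale d x) = rho x &
      forall (a b : R) x y, X x -> X y -> (0 <= a)%R -> (0 <= b)%R ->
        (a `^ s + b `^ s)%R = 1%R ->
        rho (L0_add (L0_scale a x) (L0_scale b y)) <=
          (a `^ s)%:E * rho x + (b `^ s)%:E * rho y].

Definition rho_max (m : nat) (rho : 'I_m -> L0 alpha -> \bar R) x : \bar R :=
  \big[maxe/-oo]_(i < m) rho i x.

Definition modular_space X (rho : L0 alpha -> \bar R) : set (L0 alpha) :=
  [set x | X x /\ exists2 l : R, (0 < l)%R & rho (L0_scale l x) < +oo].

Definition continuous_semimodular E (rho : L0 alpha -> \bar R) : Prop :=
  forall x, E x -> forall l0 : R, (0 < l0)%R ->
    (rho (L0_scale l x) @[l --> l0^'-] --> rho (L0_scale l0 x)) /\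
    (rho (L0_scale l x) @[l --> l0^'+] --> rho (L0_scale l0 x)).

Definition Fatou_property E (N : L0 alpha -> \bar R) : Prop :=
  forall (x_ : nat -> L0 alpha) x,
    (forall m, E (x_ m)) ->
    (forall m, \forall t \ae leb alpha, 0 <= x_ m t) ->
    ereal_sup (range (fun m => N (x_ m))) < +oo ->
    (\forall t \ae leb alpha,
      {homo (fun m => x_ m t) : m k / (m <= k)%N >-> m <= k} /\
      (x_ m t @[m --> \oo] --> x t)) ->
    [/\ E x,
        {homo (fun m => N (x_ m)) : m k / (m <= k)%N >-> m <= k} &
        N (x_ m) @[m --> \oo] --> N x].

End definitions.

Section norm_Rn.
Context (R : realType) (n : nat).
Implicit Types (f : 'rV[R]_n -> R) (u v : 'rV[R]_n).

Definition is_norm f : Prop :=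
  [/\ forall u, (0 <= f u)%R,
      forall u, f u = 0%R -> u = 0%R,
      forall (a : R) u, f (a *: u)%R = (`|a| * f u)%R &
      forall u v, (f (u + v) <= f u + f v)%R].

Definition monotone_norm f : Prop :=
  is_norm f /\
  forall u v, (forall j, 0 <= u ord0 j <= v ord0 j)%R -> (f u <= f v)%R.

(* Standard basis, numbered from 0. *)
Definition std_basis (j : nat) : 'rV[R]_n := \row_(k < n) (k == j :> nat)%:R%R.

(* f (e_1 + sum_(i = 2)^n t_i e_i) for t_2, ..., t_n in [0, +oo] given as
   t 0, ..., t (n - 2). *)
Definition norm_ext f (t : 'I_n.-1 -> \bar R) : \bar R :=
  if [exists i, t i == +oo] then +oo
  else (f (std_basis 0 +
           \sum_(i < n.-1) fine (t i) *: std_basis i.+1)%R)%:E.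

End norm_Rn.

Definition s_norm (R : realType) (alpha : \bar R) (s : R) (n : nat)
    (f : 'rV[R]_n -> R) (rho : 'I_n.-1 -> L0 alpha -> \bar R)
    (x : L0 alpha) : \bar R :=
  ereal_inf [set k%:E * norm_ext f
                          (fun i => rho i (L0_scale ((k `^ s^-1)^-1)%R x))
            | k in [set k : R | (0 < k)%R]].

(* Main.v *)
Require Import Defs.
From HB Require Import structures.
From mathcomp Require Import all_boot all_order all_algebra.
From mathcomp Require Import all_classical all_reals all_analysis.
From mathcomp Require Import measurable_realfun.

Set Implicit Arguments.
Unset Strict Implicit.
Unset Printing Implicit Defensive.

Import Order.TTheory GRing.Theory Num.Theory.
Import numFieldNormedType.Exports.

Local Open Scope classical_set_scope.
Local Open Scope ring_scope.
Local Open Scope ereal_scope.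

(* Put G_x(k) = k f(e_1 + sum_i rho_i(x / k^(1/s)) e_i). By s-convexity
   k rho_i(x / k^(1/s)) decreases in k, hence
   G_x(k') <= G_x(k) + (k' - k) f(e_1) for k <= k'. If sup_m ||x_m||_f < c, then
   for each m some k_m in (0, c / f(e_1)] has G_(x_m)(k_m) < c; rounding k_m up
   to a fine grid and using that G_(x_m)(k) increases in m, the pigeonhole
   principle gives a single k with G_(x_m)(k) <= c + eps for all m. The lower
   semicontinuity of the rho_i passes this bound to G_x(k), which shows both
   that x is in X_rho and that ||x||_f <= c + eps. *)

(** * Monotone norms on R^n, extended to coordinates equal to +oo *)

Section norm_Rn_theory.
Context (R : realType) (n : nat) (f : 'rV[R]_n -> R) (hf : monotone_norm f).
Implicit Types (t u : 'I_n.-1 -> \bar R) (r q : 'I_n.-1 -> R).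

Let e (j : nat) : 'rV[R]_n := std_basis R n j.
(** The coefficient [a] of the first basis vector is kept free so that these vectors are stable
    under sums and multiples; [a = 0] encodes a perturbation of the other coordinates alone. *)
Let vec (a : R) r : 'rV[R]_n := (a *: e 0 + \sum_(i < n.-1) r i *: e i.+1)%R.

Lemma std_basis_norm_gt0 j : (j < n)%N -> (0 < f (e j))%R.
Proof.
case: hf => -[f0 f_eq0 _ _] _ jn; rewrite lt_neqAle f0 andbT eq_sym.
apply/eqP => /f_eq0 /rowP /(_ (Ordinal jn)); rewrite !mxE eqxx.
by move/eqP; rewrite oner_eq0.
Qed.

Lemma vecE a r j : (vec a r ord0 j =
  a * (j == 0 :> nat)%:R + \sum_(i < n.-1) r i * (j == i.+1 :> nat)%:R)%R.
Proof.
by rewrite !mxE summxE; congr (_ + _)%R; apply: eq_bigr => i _; rewrite !mxE.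
Qed.

Lemma norm_vec_le a b r q : (0 <= a <= b)%R ->
  (forall i, 0 <= r i <= q i)%R -> (f (vec a r) <= f (vec b q))%R.
Proof.
case: hf => _ mono /andP[a0 ab] rq; apply: mono => j; rewrite !vecE.
apply/andP; split.
  rewrite addr_ge0 ?mulr_ge0// sumr_ge0// => i _.
  by case/andP: (rq i) => ? _; rewrite mulr_ge0.
rewrite lerD ?ler_wpM2r// ler_sum// => i _.
by case/andP: (rq i) => _ ?; rewrite ler_wpM2r.
Qed.

Lemma norm_vecZ k a r : (0 <= k)%R ->
  (k * f (vec a r) = f (vec (k * a) (fun i => k * r i)))%R.
Proof.
case: hf => -[_ _ fZ _] _ k0; rewrite -{1}(ger0_norm k0) -fZ; congr (f _).
rewrite /vec scalerDr scalerA scaler_sumr; congr (_ + _)%R.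
by apply: eq_bigr => i _; rewrite scalerA.
Qed.

Lemma norm_vecD a b r q :
  (f (vec (a + b) (fun i => r i + q i)) <= f (vec a r) + f (vec b q))%R.
Proof.
case: hf => -[_ _ _ fD] _; apply: le_trans (fD _ _).
rewrite le_eqVlt; apply/orP; left; apply/eqP; congr (f _).
rewrite /vec addrACA -scalerDl -big_split /=; congr (_ + _)%R.
by apply: eq_bigr => i _; rewrite scalerDl.
Qed.

Lemma norm_vec10 a : (0 <= a)%R -> (f (vec a (fun=> 0)) = a * f (e 0))%R.
Proof.
case: hf => -[_ _ fZ _] _ a0; rewrite /vec big1 ?addr0 ?fZ ?ger0_norm// => i _.
by rewrite scale0r.
Qed.

Lemma norm_ext_fin t : (forall i, t i < +oo) ->
  norm_ext f t = (f (vec 1 (fun i => fine (t i))))%:E.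
Proof.
move=> tfin; rewrite /norm_ext /vec scale1r ifF//.
by apply/existsP => -[i /eqP ti]; move: (tfin i); rewrite ti ltxx.
Qed.

Lemma norm_ext_lty t : norm_ext f t < +oo -> forall i, t i < +oo.
Proof.
rewrite /norm_ext; case: ifPn => [|/existsPn tfin _ i]; first by rewrite ltxx.
by rewrite lt_neqAle leey andbT tfin.
Qed.

Lemma le_norm_ext t u : (forall i, 0 <= t i) -> (forall i, t i <= u i) ->
  norm_ext f t <= norm_ext f u.
Proof.
move=> t0 tu; have [|ufin] := leP +oo (norm_ext f u).
  by rewrite leye_eq => /eqP ->; exact: leey.
have {}ufin := norm_ext_lty ufin.
have tfin i : t i < +oo by exact: le_lt_trans (tu i) (ufin i).
rewrite !norm_ext_fin// lee_fin norm_vec_le ?ler01 ?lexx// => i.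
rewrite fine_ge0//= fine_le// ge0_fin_numE//.
exact: le_trans (t0 i) (tu i).
Qed.

(** Multiplied by k, this becomes k f(e_1) <= G_x(k), which confines nearly optimal k to a bounded
    interval. *)
Lemma norm_ext_ge1 t : (forall i, 0 <= t i) -> (f (e 0))%:E <= norm_ext f t.
Proof.
move=> t0; have -> : (f (e 0))%:E = norm_ext f (fun=> 0).
  by rewrite norm_ext_fin//= norm_vec10 ?ler01// mul1r.
exact: le_norm_ext.
Qed.

(* When [k t_i] decreases as [k] increases, only the coefficient [k] of the
   first basis vector can make [k f (e_1 + sum_i t_i e_i)] grow. *)
Lemma norm_ext_step k k' t u : (0 < k <= k')%R -> (forall i, 0 <= u i) ->
  (forall i, k'%:E * u i <= k%:E * t i) ->
  k'%:E * norm_ext f u <= k%:E * norm_ext f t + ((k' - k) * f (e 0))%:E.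
Proof.
move=> /andP[k0 kk'] u0 ut; have k'0 := lt_le_trans k0 kk'.
have [|tfin] := leP +oo (norm_ext f t).
  by rewrite leye_eq => /eqP ->; rewrite gt0_muley ?lte_fin// addye// leey.
have {}tfin := norm_ext_lty tfin.
(* Nonnegativity of [t] comes from 0 <= k' u_i <= k t_i. *)
have t0 i : 0 <= t i.
  rewrite -(@lee_pmul2l _ k%:E) ?lte_fin// mule0; apply: le_trans (ut i).
  by rewrite mule_ge0// lee_fin ltW.
have ufin i : u i < +oo.
  rewrite -(@lte_pmul2l _ k'%:E) ?lte_fin// gt0_muley ?lte_fin//.
  apply: le_lt_trans (ut i) _.
  by rewrite lte_mul_pinfty ?lee_fin 1?ltW.
rewrite !norm_ext_fin// -!EFinM -EFinD lee_fin !norm_vecZ ?(ltW k0) ?(ltW k'0)//.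
(* Since (k' - k) f(e_1) is the norm of (k' - k) e_1, the triangle inequality leaves a
   coordinatewise comparison, with equal first coefficients k' and k + (k' - k). *)
rewrite -norm_vec10 ?subr_ge0//; apply: le_trans (norm_vecD _ _ _ _).
apply: norm_vec_le => [|i]; first by rewrite !mulr1 subrKC lexx andbT ltW.
rewrite mulr_ge0 ?(ltW k'0) ?fine_ge0//= addr0.
rewrite -lee_fin !EFinM !fineK ?ge0_fin_numE//.
Qed.

(** A single summand lies coordinatewise below the whole vector; hence a bound on [norm_ext] bounds
    each coordinate. *)
Lemma norm_ext_coord_le t i : (forall j, 0 <= t j) ->
  t i * (f (e i.+1))%:E <= norm_ext f t.
Proof.
move=> t0; have [|tfin] := leP +oo (norm_ext f t).
  by rewrite leye_eq => /eqP ->; rewrite leey.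
have {}tfin := norm_ext_lty tfin.
rewrite norm_ext_fin// -[t i]fineK ?ge0_fin_numE// -EFinM lee_fin.
have ti0 : (0 <= fine (t i))%R by exact: fine_ge0.
case: (hf) => -[_ _ fZ _] _.
have -> : (fine (t i) * f (e i.+1) =
    f (vec 0 (fun j => if j == i then fine (t i) else 0)))%R.
  rewrite /vec scale0r add0r (bigD1 i)//= eqxx big1 ?addr0 ?fZ ?ger0_norm//.
  by move=> j /negbTE ->; rewrite scale0r.
apply: norm_vec_le => [|j]; first by rewrite lexx ler01.
by have [->|_] := eqVneq; rewrite ?lexx ?ti0// fine_ge0.
Qed.

(** Carries the lower semicontinuity of the rho_i over to G_x(k): the coordinate suprema are finite,
    all coordinates are nearly attained at one common index, and the triangle inequality controls
    the error. *)
Lemma norm_ext_sup_le (u : nat -> 'I_n.-1 -> \bar R) t (B : R) :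
  (forall m i, 0 <= u m i) ->
  (forall i, {homo u ^~ i : m k / (m <= k)%N >-> m <= k}) ->
  (forall i, 0 <= t i) ->
  (forall i, t i <= ereal_sup (range (u ^~ i))) ->
  (forall m, norm_ext f (u m) <= B%:E) -> norm_ext f t <= B%:E.
Proof.
move=> u0 u_nd t0 tu uB.
have ufin m i : u m i < +oo.
  exact: norm_ext_lty (le_lt_trans (uB m) (ltry B)) i.
have e0 (i : 'I_n.-1) : (0 < f (e i.+1))%R.
  by apply: std_basis_norm_gt0; rewrite -ltn_predRL.
have sfin i : ereal_sup (range (u ^~ i)) < +oo.
  apply: (@le_lt_trans _ _ (B / f (e i.+1))%:E); last exact: ltry.
  apply: ge_ereal_sup => _ [m _ <-].
  rewrite EFinM lee_pdivlMr//.
  exact: le_trans (norm_ext_coord_le _ (u0 m)) (uB m).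
have tfin i : t i < +oo by exact: le_lt_trans (tu i) (sfin i).
apply/lee_addgt0Pr => d d0.
(* Raising all coordinates by d / c costs (d / c) f(0, 1, ..., 1) <= d; the summand 1 makes [c]
   positive. *)
pose c := (1 + f (vec 0 (fun=> 1)))%R.
have c0 : (0 < c)%R by case: (hf) => -[f0 _ _ _] _; rewrite ltr_pwDl.
have dc0 : (0 < d / c)%R by rewrite divr_gt0.
(* There are finitely many [i], so one [m] serves all of them. *)
have : \forall m \near \oo, forall i, t i <= u m i + (d / c)%:E.
  apply: filter_forall => i.
  have : t i - (d / c)%:E < ereal_sup (range (u ^~ i)).
    apply: lt_le_trans (tu i).
    by rewrite lteBlDr// lteDl ?lte_fin// ge0_fin_numE.
  move=> /ereal_sup_gt[_ [m _ <-] tum].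
  near=> k; rewrite -leeBlDr//; apply/ltW/(lt_le_trans tum).
  by apply: u_nd; near: k; exact: nbhs_infty_ge.
case=> m _ /(_ m (leqnn m)) tum.
have uBm := uB m; move: uBm; rewrite !norm_ext_fin// => uBm.
apply: (@le_trans _ _
  (f (vec 1 (fun i => fine (u m i))) + f (vec 0 (fun=> d / c)))%R%:E).
  rewrite lee_fin; apply: le_trans (norm_vecD _ _ _ _).
  apply: norm_vec_le => [|i]; first by rewrite addr0 ler01 lexx.
  rewrite fine_ge0//= -lee_fin EFinD !fineK ?ge0_fin_numE//.
rewrite EFinD leeD// lee_fin.
have -> : f (vec 0 (fun=> d / c)%R) = (d / c * f (vec 0 (fun=> 1)))%R.
  rewrite norm_vecZ ?ltW// mulr0; congr (f (vec _ _)).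
  by apply/funext => i; rewrite mulr1.
by rewrite mulrAC ler_pdivrMr// ler_wpM2l ?(ltW d0)// /c lerDr ler01.
Unshelve. all: by end_near. Qed.

End norm_Rn_theory.

(** * Scalar multiples of classes in L0 *)

Section L0_scale_theory.
Context (R : realType) (alpha : \bar R).
Implicit Types x : L0 alpha.

Lemma L0_scaleA (a b : R) x : L0_scale a (L0_scale b x) = L0_scale (a * b) x.
Proof.
apply/L0_eqP; move: (L0_scaleE a (L0_scale b x)) (L0_scaleE b x)
  (L0_scaleE (a * b) x).
by apply: filterS3 => t -> -> ->; rewrite EFinM muleA.
Qed.

Lemma L0_scale1 x : L0_scale 1 x = x.
Proof.
by apply/L0_eqP; apply: filterS (L0_scaleE 1 x) => t ->; rewrite mul1e.
Qed.

Lemma L0_add_scale0 (b : R) x : L0_add x (L0_scale b (L0_zero alpha)) = x.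
Proof.
apply/L0_eqP; move: (L0_addE x (L0_scale b (L0_zero alpha)))
  (L0_scaleE b (L0_zero alpha)) (L0_zeroE alpha).
by apply: filterS3 => t -> -> ->; rewrite mule0 adde0.
Qed.

End L0_scale_theory.

(** * Dilations under an s-convex semimodular *)

Section semimodular_theory.
Context (R : realType) (alpha : \bar R) (X : set (L0 alpha)).
Hypothesis hX : linear_subspace X.
Context (s : R) (rho : L0 alpha -> \bar R).
Hypotheses (s0 : (0 < s)%R) (hrho : semimodular s X rho).

(** Convexity with second vector 0, whose weight b^s = 1 - a^s contributes nothing since rho(0) =
    0. *)
Lemma semimodular_scale_le (a : R) x : X x -> (0 <= a <= 1)%R ->
  rho (L0_scale a x) <= (a `^ s)%:E * rho x.
Proof.
case: hX hrho => X0 _ _ _ [_ rho0 _ _ conv] Xx /andP[a0 a1].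
have as1 : (a `^ s <= 1)%R.
  rewrite (_ : 1%R = (1 `^ s)%R); last by rewrite powR1.
  by rewrite ge0_ler_powR ?nnegrE ?(ltW s0).
pose b := ((1 - a `^ s) `^ s^-1)%R.
have := conv a b x _ Xx X0 a0 (powR_ge0 _ _).
rewrite L0_add_scale0 rho0 mule0 adde0; apply.
by rewrite /b -powRrM mulVf ?gt_eqF// powRr1 ?subr_ge0// subrKC.
Qed.

(** x / k'^(1/s) is the multiple of x / k^(1/s) by a = (k / k')^(1/s) <= 1, and the factor a^s = k /
    k' gained from convexity turns k' into k. *)
Lemma semimodular_dilation_le (k k' : R) x : X x -> (0 < k <= k')%R ->
  k'%:E * rho (L0_scale (k' `^ s^-1)^-1 x) <=
  k%:E * rho (L0_scale (k `^ s^-1)^-1 x).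
Proof.
move=> Xx /andP[k0 kk']; have k'0 := lt_le_trans k0 kk'.
have XZ (a : R) : X (L0_scale a x) by case: hX => _ _ + _; apply.
have p0 : (0 < k `^ s^-1)%R by exact: powR_gt0.
have p'0 : (0 < k' `^ s^-1)%R by exact: powR_gt0.
pose a := (k `^ s^-1 / k' `^ s^-1)%R.
have a01 : (0 <= a <= 1)%R.
  rewrite divr_ge0 ?powR_ge0//= ler_pdivrMr// mul1r.
  by rewrite ge0_ler_powR ?nnegrE ?invr_ge0  ?(ltW k0) ?(ltW k'0) ?(ltW s0).
have as_ : (a `^ s = k / k')%R.
  have pK (y : R) : (0 < y)%R -> ((y `^ s^-1) `^ s = y)%R.
    by move=> y0; rewrite -powRrM mulVf ?gt_eqF// powRr1 ?ltW.
  apply: (mulIf (lt0r_neq0 k'0)); rewrite divfK ?gt_eqF//.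
  rewrite -{1}(pK _ k'0) -powRM ?divr_ge0 ?powR_ge0//.
  by rewrite divfK ?gt_eqF// pK.
have := semimodular_scale_le (XZ (k `^ s^-1)^-1%R) a01.
rewrite L0_scaleA as_ {1}/a mulrAC mulfV ?gt_eqF// mul1r => le_rho.
apply: (@le_trans _ _
  (k'%:E * ((k / k')%:E * rho (L0_scale (k `^ s^-1)^-1 x)))).
  by rewrite lee_pmul2l.
by rewrite muleA -EFinM mulrCA mulfV ?gt_eqF// mulr1.
Qed.

End semimodular_theory.

(** * One scale for a whole increasing sequence *)

(* Pigeonhole on the grid [d, 2d, ..., Jd], by induction on [J]. *)
Lemma common_scale_grid (R : realType) (G : nat -> R -> \bar R) (c d L : R) J :
  (0 < d)%R -> (0 <= L)%R ->
  (forall k : R, (0 < k)%R -> {homo G ^~ k : m p / (m <= p)%N >-> m <= p}) ->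
  (forall m (k k' : R), (0 < k <= k')%R -> G m k' <= G m k + ((k' - k) * L)%:E) ->
  (forall m, exists2 k : R, (0 < k <= J%:R * d)%R & G m k <= c%:E) ->
  exists2 k : R, (0 < k)%R & forall m, G m k <= (c + d * L)%:E.
Proof.
(* With J = 0 no k fits in (0, 0]. *)
move=> d0 L0 G_nd G_step; elim: J => [/(_ 0%N)[k]|J IH Gc].
  by rewrite mul0r => /andP[k0 /(lt_le_trans k0)]; rewrite ltxx.
have Jd0 : (0 < J.+1%:R * d)%R by rewrite mulr_gt0.
have [all_le|/existsNP[p /negP]] :=
    pselect (forall m, G m (J.+1%:R * d)%R <= (c + d * L)%:E).
  by exists (J.+1%:R * d)%R.
rewrite -ltNge => Gp; apply: IH => m.
(* When the node (J+1) d fails for [p], a good k for max(m, p) is also good for [m] and [p], and it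
   is at most J d: otherwise a step shorter than d would reach the node at cost at most d L. *)
have [k /andP[k0 kJ] Gk] := Gc (maxn m p).
exists k; last by apply: le_trans Gk; apply: G_nd => //; exact: leq_maxl.
rewrite k0 /= leNgt; apply/negP => Jk; move: Gp; apply/negP; rewrite -leNgt.
apply: le_trans (G_nd _ Jd0 _ _ (leq_maxr m p)) _.
have k_in : (0 < k <= J.+1%:R * d)%R by apply/andP.
apply: le_trans (G_step _ _ _ k_in) _.
rewrite EFinD leeD// lee_fin ler_wpM2r// lerBlDr.
by rewrite -natr1 mulrDl mul1r addrC lerD2l ltW.
Qed.

(** The mesh [d] is chosen with d L <= eps, and the grid is long enough to cover (0, K]. *)
Lemma common_scale (R : realType) (G : nat -> R -> \bar R) (c K L eps : R) :
  (0 < eps)%R -> (0 <= L)%R ->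
  (forall k : R, (0 < k)%R -> {homo G ^~ k : m p / (m <= p)%N >-> m <= p}) ->
  (forall m (k k' : R), (0 < k <= k')%R -> G m k' <= G m k + ((k' - k) * L)%:E) ->
  (forall m, exists2 k : R, (0 < k <= K)%R & G m k <= c%:E) ->
  exists2 k : R, (0 < k)%R & forall m, G m k <= (c + eps)%:E.
Proof.
move=> eps0 L0 G_nd G_step Gc.
have L1 : (0 < 1 + L)%R by rewrite ltr_pwDl.
(* The denominator 1 + L stays positive when L = 0. *)
pose d := (eps / (1 + L))%R; have d0 : (0 < d)%R by rewrite divr_gt0.
have [|k k0 Gk] :=
  @common_scale_grid R G c d L (Num.truncn (K / d)).+1 d0 L0 G_nd G_step.
  move=> m; have [k /andP[k0 kK] Gk] := Gc m; exists k => //.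
  by rewrite k0 (le_trans kK)// -ler_pdivrMr// ltW// truncnS_gt.
exists k => // m; apply: le_trans (Gk m) _; rewrite lee_fin lerD2l.
by rewrite /d mulrAC ler_pdivrMr// ler_wpM2l ?ltW// ltrDr.
Qed.

(** * Fatou property of the s-norm *)

Theorem theorem4p4 (R : realType)
  (alpha : \bar R) (halpha : alpha = 1%:E \/ alpha = +oo)
  (X : set (L0 alpha)) (hX : linear_subspace X)
  (s : R) (hs : (0 < s <= 1)%R)
  (n : nat) (hn : (2 <= n)%N)
  (rho : 'I_n.-1 -> L0 alpha -> \bar R)
  (hrho : forall i, semimodular s X (rho i))
  (hrho_out : forall i z, ~ X z -> rho i z = +oo)
  (hi : forall x y : L0 alpha, modular_space X (rho_max rho) x ->
     (\forall t \ae leb alpha, `|y t| <= `|x t|) ->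
     modular_space X (rho_max rho) y /\
     forall (l : R) i, (0 < l)%R ->
       rho i (L0_scale l y) <= rho i (L0_scale l x))
  (hii : exists2 x : L0 alpha, modular_space X (rho_max rho) x &
     \forall t \ae leb alpha, 0 < x t)
  (hiii : forall x_ : nat -> L0 alpha,
     (forall m, modular_space X (rho_max rho) (x_ m)) ->
     (forall l : R, (0 < l)%R ->
        rho_max rho (L0_scale l (L0_sub (x_ kj.1) (x_ kj.2)))
          @[kj --> (\oo, \oo)] --> 0) ->
     exists2 x : L0 alpha, modular_space X (rho_max rho) x &
       forall l : R, (0 < l)%R ->
         rho_max rho (L0_scale l (L0_sub (x_ m) x)) @[m --> \oo] --> 0)
  (f : 'rV[R]_n -> R) (hf : monotone_norm f)
  (hcont : forall i,
     continuous_semimodular (modular_space X (rho_max rho)) (rho i))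
  (hliminf : forall (x_ : nat -> L0 alpha) (x : L0 alpha),
     (forall m, modular_space X (rho_max rho) (x_ m)) ->
     (\forall t \ae leb alpha,
        `|x t| <= limn_einf (fun m => `|x_ m t|)) ->
     forall i (l : R), (0 < l)%R ->
       rho i (L0_scale l x) <= limn_einf (fun m => rho i (L0_scale l (x_ m)))) :
  Fatou_property (modular_space X (rho_max rho)) (s_norm s f rho).
Proof.
case/andP: hs => s0 _.
pose E := modular_space X (rho_max rho).
have XZ (a : R) y : X y -> X (L0_scale a y) by case: hX => _ _ + _; apply.
(* The value +oo outside X extends nonnegativity to all of L0; the limit [x] is not known to lie in
   X until late. *)
have rho_ge0 i y : 0 <= rho i y.
  have [Xy|/hrho_out ->] := pselect (X y); last exact: le0y.
  by case: (hrho i) => + _ _ _ _; apply.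
(* This is G_y(k), whose infimum over k > 0 is the s-norm. *)
pose g k y := k%:E *
  norm_ext f (fun i => rho i (L0_scale ((k `^ s^-1)^-1)%R y)).
have pV0 (k : R) : (0 < k)%R -> (0 < (k `^ s^-1)^-1)%R.
  by move=> k0; rewrite invr_gt0 powR_gt0.
have g_le (y z : L0 alpha) (k : R) :
    E z -> (\forall t \ae leb alpha, `|y t| <= `|z t|) ->
    (0 < k)%R -> g k y <= g k z.
  move=> Ez yz k0; rewrite lee_pmul2l ?lte_fin//.
  apply: le_norm_ext => // i.
  exact: (hi _ _ Ez yz).2 _ _ (pV0 _ k0).
have N_le_g y (k : R) : (0 < k)%R -> s_norm s f rho y <= g k y.
  by move=> k0; apply: ereal_inf_lbound; exists k.
have N_le (y z : L0 alpha) :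
    E z -> (\forall t \ae leb alpha, `|y t| <= `|z t|) ->
    s_norm s f rho y <= s_norm s f rho z.
  move=> Ez yz; apply: le_ereal_inf_tmp => _ [k /= k0 <-].
  exact: le_trans (N_le_g _ _ k0) (g_le _ _ _ Ez yz k0).
have e0 : (0 < f (std_basis R n 0))%R.
  by apply: std_basis_norm_gt0 => //; exact: ltnW.
have g_ge y (k : R) : (0 < k)%R -> (k * f (std_basis R n 0))%:E <= g k y.
  by move=> k0; rewrite EFinM lee_pmul2l ?lte_fin// norm_ext_ge1.
have N_ge0 y : 0 <= s_norm s f rho y.
  apply: le_ereal_inf_tmp => _ [k /= k0 <-]; apply: le_trans (g_ge _ _ k0).
  by rewrite lee_fin mulr_ge0 ?ltW.
move=> x_ x Ex_ x_ge0 Nfin x_cvg.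
have le_abs m p : (m <= p)%N -> \forall t \ae leb alpha, `|x_ m t| <= `|x_ p t|.
  move=> mp; move: (x_ge0 m) (x_ge0 p) x_cvg; apply: filterS3 => t xm xp [+ _].
  by move=> /(_ _ _ mp); rewrite !gee0_abs.
have le_absx m : \forall t \ae leb alpha, `|x_ m t| <= `|x t|.
  move: (x_ge0 m) x_cvg; apply: filterS2 => t xm [x_nd x_x].
  have xmx : x_ m t <= x t.
    rewrite -(cvg_lim _ x_x)//; apply: lime_ge.
      by apply/cvg_ex; exists (x t).
    by exists m => // p; exact: x_nd.
  by rewrite !gee0_abs// (le_trans xm).
have x_liminf : \forall t \ae leb alpha,
    `|x t| <= limn_einf (fun m => `|x_ m t|).
  apply: filterS x_cvg => t [_ /cvg_abse x_x].
  by rewrite (cvg_limn_einf_sup x_x).1.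
have rho_nd i (l : R) : (0 < l)%R ->
    {homo (fun m => rho i (L0_scale l (x_ m))) : m p / (m <= p)%N >-> m <= p}.
  by move=> l0 m p mp; exact: (hi _ _ (Ex_ p) (le_abs _ _ mp)).2 _ _ l0.
(* Here [x] is only known to be in L0. The values along the sequence are nondecreasing, so their
   liminf is their supremum. *)
have rho_le_sup i (l : R) : (0 < l)%R -> rho i (L0_scale l x) <=
    ereal_sup (range (fun m => rho i (L0_scale l (x_ m)))).
  move=> l0; have := hliminf _ _ Ex_ x_liminf i _ l0.
  by have [-> _] := cvg_limn_einf_sup (ereal_nondecreasing_cvgn (rho_nd i l l0)).
have g_sup (k B : R) : (0 < k)%R -> (forall m, g k (x_ m) <= B%:E) ->
    g k x <= B%:E.
  move=> k0 gB; rewrite /g muleC -lee_pdivlMr// -EFinM.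
  apply: (norm_ext_sup_le hf (u := fun m i =>
      rho i (L0_scale ((k `^ s^-1)^-1)%R (x_ m)))) => //.
  - by move=> i m p; apply: rho_nd; exact: pV0.
  - by move=> i; apply: rho_le_sup; exact: pV0.
  - by move=> m; rewrite EFinM lee_pdivlMr// muleC gB.
pose S := ereal_sup (range (fun m => s_norm s f rho (x_ m))).
have N_le_S m : s_norm s f rho (x_ m) <= S by apply: ereal_sup_ubound; exists m.
have S_fin : S \is a fin_num.
  by rewrite ge0_fin_numE//; exact: le_trans (N_ge0 (x_ 0%N)) (N_le_S 0%N).
have g_x (eps : R) : (0 < eps)%R -> exists2 k : R, (0 < k)%R & g k x <= S + eps%:E.
  (* Half of [eps] makes ||x_m||_f < c strict, so that some k has G_(x_m)(k) < c; the other half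
     pays for a common k. The bound c / f(e_1) on k comes from k f(e_1) <= G_(x_m)(k). *)
  move=> eps0; pose c := (fine S + eps / 2)%R.
  have [|||m k k' /andP[k0 kk']|m|k k0 gk] := @common_scale R
      (fun m k => g k (x_ m)) c (c / f (std_basis R n 0)) (f (std_basis R n 0))
      (eps / 2).
  - by rewrite divr_gt0.
  - exact: ltW.
  - by move=> k k0 m p mp; apply: g_le (Ex_ p) (le_abs _ _ mp) k0.
  - apply: norm_ext_step => // [|i]; first by rewrite k0.
    apply: (semimodular_dilation_le hX s0 (hrho i)); last by rewrite k0.
    by case: (Ex_ m).
  - have : s_norm s f rho (x_ m) < c%:E.
      apply: le_lt_trans (N_le_S m) _.
      by rewrite /c EFinD fineK// lteDl// lte_fin divr_gt0.
    move=> /ereal_inf_lt[_ [k /= k0 <-] gkc]; exists k; last exact: ltW.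
    rewrite k0 ler_pdivlMr// -lee_fin; apply: le_trans (g_ge _ _ k0) _.
    exact: ltW gkc.
  - exists k => //; rewrite (_ : S + eps%:E = (c + eps / 2)%:E); first exact: g_sup.
    by rewrite /c -addrA -splitr EFinD fineK.
have Ex : E x.
  (* Any fixed positive eps yields a scale at which all rho_i are finite. *)
  have [k k0 gk] := g_x 1%R ltr01.
  have rfin : forall i, rho i (L0_scale ((k `^ s^-1)^-1)%R x) < +oo.
    apply: (@norm_ext_lty _ _ f).
    rewrite -(@lte_pmul2l _ k%:E) ?lte_fin// gt0_muley ?lte_fin//.
    by apply: le_lt_trans gk _; rewrite -(fineK S_fin) -EFinD ltry.
  split; last by exists ((k `^ s^-1)^-1)%R; [exact: pV0|exact: bigmax_lt].
  (* As n >= 2, some rho_i exists; its finite value at x / k^(1/s) puts this multiple in X, because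
     rho_i is +oo outside X. Rescaling then gives [x] in X. *)
  have n0 : (0 < n.-1)%N by rewrite ltn_predRL.
  have : X (L0_scale ((k `^ s^-1)^-1)%R x).
    apply: contrapT => /(hrho_out (Ordinal n0)) rhoy.
    by move: (rfin (Ordinal n0)); rewrite rhoy ltxx.
  move=> /(XZ (k `^ s^-1)%R); rewrite L0_scaleA mulfV ?L0_scale1//.
  by rewrite gt_eqF// powR_gt0.
have N_nd : {homo (fun m => s_norm s f rho (x_ m)) :
    m p / (m <= p)%N >-> m <= p}.
  by move=> m p mp; exact: N_le (Ex_ p) (le_abs _ _ mp).
split=> //; suff -> : s_norm s f rho x = S by exact: ereal_nondecreasing_cvgn.
(* ||x||_f <= S follows by letting eps tend to 0; the converse rests on |x_m| <= |x| and on [Ex]. *)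
apply/eqP; rewrite eq_le; apply/andP; split.
  apply/lee_addgt0Pr => eps eps0; have [k k0 gk] := g_x eps eps0.
  exact: le_trans (N_le_g _ _ k0) gk.
by apply: ge_ereal_sup => _ [m _ <-]; exact: N_le Ex (le_absx m).
Qed.
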